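(* Let $G$ be a finitely generated abstract group. Assume that (a) $G$ has either trivial virtual center or the unique root property; (b) for every $n\in\mathbb N$ there exist pairwise isomorphic finite index normal subgroups $U_1,\ldots,U_n$ of $G$ such that the quotients $G/U_i$ and $G/U_j$ have distinct (multisets of) composition factors for all $i\neq j$. Then the quotient $\mathrm{Comm}(G)/\mathrm{AComm}(G)$ is infinite.
   Context: The virtual center of a group $G$ is the set of elements $g\in G$ which centralize a finite index subgroup of $G$. $G$ has the unique root property if $g^n=h^n$ with $g,h\in G$ and $n\geq 1$ implies $g=h$. Composition factors are considered up to isomorphism and with multiplicity. $\mathrm{Comm}(G)$ is the group of equivalence classes $[f]$ of isomorphisms $f:A\to B$ between finite index subgroups of $G$, where two such isomorphisms are equivalent if they coincide on some finite index subgroup of $G$, with product $[f_1][f_2]=[f_1\circ f_2]$ (for $f_i:A_i\to B_i$, the composition is defined on $f_2^{-1}(B_2\cap A_1)$). For a finite index subgroup $H$ of $G$ there is a canonical homomorphism $\mathrm{Aut}(H)\to\mathrm{Comm}(G)$, $\phi\mapsto[\phi]$. $\mathrm{AComm}(G)$ is the subgroup of $\mathrm{Comm}(G)$ generated by the canonical images of the groups $\mathrm{Aut}(H)$, where $H$ ranges over all finite index subgroups of $G$; it is normal in $\mathrm{Comm}(G)$ when $G$ is finitely generated. *)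

(* Defs.v *)
From HB Require Import structures.
From mathcomp Require Import all_boot all_fingroup all_solvable.
From mathcomp Require Import boolp classical_sets functions cardinality.
From mathcomp Require Import generic_quotient.

Set Implicit Arguments.
Unset Strict Implicit.
Unset Printing Implicit Defensive.

Local Open Scope classical_set_scope.
Local Open Scope group_scope.
Local Open Scope quotient_scope.

(* Subgroups of a group G are the library's boolean subgroup predicates
   [groupClosed G]; membership is classical, so nothing is lost. *)

Section Subgroups.
Variable G : groupType.
Implicit Types (X : set G) (H K : groupClosed G).

Definition mk_subgroup (S : {pred G}) (h : group_closed S) : groupClosed G :=
  HB.pack S (isMul1Closed.Build G S (proj1 h))
            (isMulClosed.Build G S (group_closedM h))
            (isInvClosed.Build G S (group_closedV h)).

Definition generated_pred X : {pred G} :=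
  fun x => `[< forall H : groupClosed G, X `<=` [set` H] -> x \in H >].

Lemma generated_closed X : group_closed (generated_pred X).
Proof.
split; first by apply/asboolP => H _; exact: gpred1.
move=> x y /asboolP hx /asboolP hy; apply/asboolP => H XH.
by apply: gpredF; [exact: hx | exact: hy].
Qed.

Definition generated X : groupClosed G := mk_subgroup (generated_closed X).

Definition finitely_generated : Prop :=
  exists s : seq G, forall x : G, x \in generated [set` s].

Definition lcoset_rel H : rel G := fun x y => x^-1 * y \in H.

Lemma lcoset_rel_equiv H : equiv_class_of (lcoset_rel H).
Proof.
split=> [x|x y|y x z]; rewrite /lcoset_rel.
- by rewrite mulVg; exact: gpred1.
- by rewrite -gpredV invgM invgK.
- by move=> hx hy; rewrite -[z](mulKVg y) mulgA gpredM.
Qed.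

Canonical lcoset_equiv H : equiv_rel G := EquivRelPack (lcoset_rel_equiv H).

(* H need not be normal: cosets H is the set G/H of left cosets, and the group
   structure is put below on cosets U for U normal. *)
Definition cosets H := {eq_quot lcoset_equiv H}.
HB.instance Definition _ H := EqQuotient.on (cosets H).
HB.instance Definition _ H := Choice.on (cosets H).

Lemma cosetsP H (x y : G) : (\pi_(cosets H) x = \pi_(cosets H) y) <-> x^-1 * y \in H.
Proof. by split=> [/eqmodP //|h]; apply/eqmodP. Qed.

Definition finite_index H : Prop := finite_set [set: cosets H].

Record normal_subgroup := NormalSubgroup {
  normal_val :> groupClosed G;
  normal_conj : forall x g : G, x \in normal_val -> x ^ g \in normal_val }.

Record fin_normal_subgroup := FinNormalSubgroup {
  fin_normal_val :> normal_subgroup;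
  fin_normal_index : finite_index fin_normal_val }.

End Subgroups.

Section Quotient.
Variables (G : groupType) (U : normal_subgroup G).

Definition quot := cosets U.
HB.instance Definition _ := EqQuotient.on quot.
HB.instance Definition _ := Choice.on quot.

Definition quot_mul : quot -> quot -> quot := lift_op2 quot (fun x y : G => x * y).
Definition quot_inv : quot -> quot := lift_op1 quot (fun x : G => x^-1).
Definition quot_one : quot := \pi_quot 1.

Lemma quotP (x y : G) : (\pi_quot x = \pi_quot y) <-> x^-1 * y \in normal_val U.
Proof. exact: cosetsP. Qed.

Lemma quot_repr (x : G) : (repr (\pi_quot x))^-1 * x \in normal_val U.
Proof. by apply/quotP; rewrite reprK. Qed.

Lemma quot_mulE (x y : G) : quot_mul (\pi_quot x) (\pi_quot y) = \pi_quot (x * y).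
Proof.
rewrite /quot_mul; unlock; apply/quotP.
have hx := quot_repr x; have hy := quot_repr y.
set a := repr _ in hx *; set b := repr _ in hy *.
have -> : (a * b)^-1 * (x * y) = (a^-1 * x) ^ b * (b^-1 * y).
  by rewrite /conjg invgM !mulgA mulgK.
by apply: gpredM => //; apply: normal_conj.
Qed.

Lemma quot_invE (x : G) : quot_inv (\pi_quot x) = \pi_quot (x^-1).
Proof.
rewrite /quot_inv; unlock; apply/quotP.
have := quot_repr x; set a := repr _ => hx.
have -> : a^-1^-1 * x^-1 = ((a^-1 * x) ^ x^-1)^-1 ^ 1.
  by rewrite conjg1 /conjg !invgM !invgK !mulgA mulgV mul1g.
by rewrite conjg1 gpredV; apply: normal_conj.
Qed.

Fact quot_mulA : associative quot_mul.
Proof.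
elim/quotW=> x; elim/quotW=> y; elim/quotW=> z.
by rewrite !quot_mulE mulgA.
Qed.

Fact quot_mul1 : left_id quot_one quot_mul.
Proof. by elim/quotW=> x; rewrite quot_mulE mul1g. Qed.

Fact quot_mulg1 : right_id quot_one quot_mul.
Proof. by elim/quotW=> x; rewrite quot_mulE mulg1. Qed.

Fact quot_mulV : left_inverse quot_one quot_inv quot_mul.
Proof. by elim/quotW=> x; rewrite quot_invE quot_mulE mulVg. Qed.

Fact quot_mulgV : right_inverse quot_one quot_inv quot_mul.
Proof. by elim/quotW=> x; rewrite quot_invE quot_mulE mulgV. Qed.

HB.instance Definition _ :=
  isGroup.Build quot quot_mulA quot_mul1 quot_mulg1 quot_mulV quot_mulgV.

Lemma quot_piM : {morph \pi_quot : x y / x * y}.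
Proof. by move=> x y; rewrite -quot_mulE. Qed.

End Quotient.

Section FiniteQuotient.
Variables (G : groupType) (U : fin_normal_subgroup G).

Definition fin_quot := quot U.
HB.instance Definition _ := Group.on fin_quot.

Fact fin_quot_enum : {s : seq fin_quot | Finite.axiom s}.
Proof.
apply: cid; have /finite_seqP[s hs] : finite_set [set: fin_quot].
  exact: (fin_normal_index U).
exists (undup s) => x; rewrite count_uniq_mem ?undup_uniq // mem_undup.
by have : [set: fin_quot] x by []; rewrite hs /= => ->.
Qed.

Let enumq := sval fin_quot_enum.

Fact fin_quot_pickleK :
  pcancel (index^~ enumq) (fun n => nth None (map some enumq) n).
Proof.
move=> x; have xs : x \in enumq.
  by rewrite -has_pred1 has_count (svalP fin_quot_enum).
by rewrite (nth_map x) ?index_mem // nth_index.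
Qed.

HB.instance Definition _ := isCountable.Build fin_quot fin_quot_pickleK.
HB.instance Definition _ := isFinite.Build fin_quot (svalP fin_quot_enum).

End FiniteQuotient.


Section CompositionFactors.
Variables gT rT : finGroupType.

(* [comps] and [mkfactors] are the composition series and their lists of
   factors from solvable.jordanholder; by [JordanHolderUniqueness] the choice of
   the series s and t is immaterial. *)
Definition same_composition_factors : Prop :=
  exists s : seq {group gT}, exists t : seq {group rT},
  [/\ comps [set: gT]%G s, comps [set: rT]%G t &
      exists2 fs : seq (section rT),
        perm_eq fs (mkfactors [set: rT]%G t) &
        all2 (fun (x : section gT) (y : section rT) => x \isog y)
             (mkfactors [set: gT]%G s) fs].

End CompositionFactors.

Section Isomorphisms.
Variable G : groupType.
Implicit Types (A B H K : groupClosed G).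

(* Only the values of f on A matter. *)
Definition is_iso A B (f : G -> G) : Prop :=
  set_bij [set` A] [set` B] f /\ {in A &, {morph f : x y / x * y}}.

Definition isomorphic A B : Prop := exists f, is_iso A B f.

Lemma is_iso1 A B f : is_iso A B f -> f 1 = 1.
Proof.
case=> _ fM; have A1 : 1 \in A := gpred1; have := fM 1 1 A1 A1; rewrite mulg1 => h.
by apply: (mulgI (f 1)); rewrite mulg1.
Qed.

Lemma is_isoV A B f x : is_iso A B f -> x \in A -> f x^-1 = (f x)^-1.
Proof.
move=> fi Ax; apply: (mulgI (f x)).
by rewrite mulgV -(proj2 fi) ?gpredV // mulgV (is_iso1 fi).
Qed.

Lemma is_iso_im A B f x : is_iso A B f -> x \in A -> f x \in B.
Proof. by case=> -[fAB _ _] _ Ax; exact: fAB. Qed.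

Lemma is_iso_inj A B f x y : is_iso A B f -> x \in A -> y \in A ->
  f x = f y -> x = y.
Proof.
by case=> -[_ finj _] _ Ax Ay; apply: finj; rewrite inE.
Qed.

Definition preim_pred A B (f : G -> G) : {pred G} :=
  fun x => (x \in A) && (f x \in B).

Lemma preim_closed A B K f : is_iso A B f -> group_closed (preim_pred A K f).
Proof.
move=> fi; split; first by rewrite unfold_in /preim_pred (is_iso1 fi) !gpred1.
move=> x y /andP[Ax Kx] /andP[Ay Ky]; apply/andP; split; first exact: gpredF.
by rewrite (proj2 fi) ?gpredV // (is_isoV fi) //; exact: gpredF.
Qed.

Lemma finite_indexP H :
  finite_index H <->
  exists (T : Type) (D : set T) (c : G -> T), [/\ finite_set D, forall x, D (c x)
    & forall x y, c x = c y -> x^-1 * y \in H].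
Proof.
split=> [Hfin|[T [D [c [Dfin cD cH]]]]].
  exists (cosets H), setT, (fun x => \pi_(cosets H) x); split=> // x y.
  by move/cosetsP.
pose g (z : cosets H) := c (repr z).
have ginj : {in g @^-1` D &, injective g}.
  by move=> u v _ _ /cH /cosetsP; rewrite !reprK.
apply: (sub_finite_set _ (finite_preimage ginj Dfin)).
by move=> z _; exact: cD.
Qed.

Lemma finite_index_preim A B K f (fi : is_iso A B f) :
  finite_index A -> finite_index K ->
  finite_index (mk_subgroup (preim_closed K fi)).
Proof.
move=> Afin Kfin; apply/finite_indexP.
pose r x := repr (\pi_(cosets A) x).
exists (cosets A * cosets K)%type, (setT `*` setT),
  (fun x => (\pi_(cosets A) x, \pi_(cosets K) (f ((r x)^-1 * x)))).
split=> //; first exact: finite_setX.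
move=> x y [exy].
have rA z : (r z)^-1 * z \in A by apply/cosetsP; rewrite reprK.
have rxy : r x = r y by rewrite /r exy.
move/cosetsP=> hK; have xyA : x^-1 * y \in A by apply/cosetsP.
apply/andP; split=> //; move: hK.
rewrite -(is_isoV fi) // -(proj2 fi) ?gpredV //.
by rewrite rxy invgM invgK -mulgA mulKVg.
Qed.

End Isomorphisms.

Section Comm.
Variable G : groupType.
Implicit Types (A B H K : groupClosed G).

Record partial_iso := PartialIso {
  dom : groupClosed G;
  cod : groupClosed G;
  pfun :> G -> G;
  dom_finite_index : finite_index dom;
  cod_finite_index : finite_index cod;
  pfunP : is_iso dom cod pfun }.

HB.instance Definition _ := gen_eqMixin partial_iso.
HB.instance Definition _ := gen_choiceMixin partial_iso.
Implicit Types f g h : partial_iso.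

(* The group where f and g coincide is required to lie in both domains: outside
   of them the values of f and g are junk. *)
Definition comm_rel : rel partial_iso := fun f g =>
  `[< exists H, [/\ finite_index H, {subset H <= dom f}, {subset H <= dom g}
                  & {in H, f =1 g}] >].

Definition id_is_iso A : is_iso A A id.
Proof. by split=> //; split=> // y Ay; exists y. Qed.

Definition cap A B : groupClosed G := mk_subgroup (preim_closed B (id_is_iso A)).

Lemma cap_finite A B :
  finite_index A -> finite_index B -> finite_index (cap A B).
Proof. exact: finite_index_preim. Qed.

Lemma comm_rel_equiv : equiv_class_of comm_rel.
Proof.
split=> [f|f g|g f h].
- by apply/asboolP; exists (dom f); split=> //; exact: dom_finite_index.
- by apply/asboolP/asboolP=> -[H [? ? ? e]]; exists H; split=> // x /e.
move=> /asboolP[H [Hi Hf Hg e]] /asboolP[K [Ki Kg Kh e']].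
apply/asboolP; exists (cap H K); split; first exact: cap_finite.
- by move=> x /andP[/Hf].
- by move=> x /andP[_ /Kh].
- by move=> x /andP[xH xK]; rewrite e // e'.
Qed.

Canonical comm_equiv : equiv_rel partial_iso := EquivRelPack comm_rel_equiv.

Definition Comm := {eq_quot comm_equiv}.
HB.instance Definition _ := EqQuotient.on Comm.
HB.instance Definition _ := Choice.on Comm.

Lemma CommP f g : (\pi_Comm f = \pi_Comm g) <->
  exists H, [/\ finite_index H, {subset H <= dom f}, {subset H <= dom g}
                  & {in H, f =1 g}].
Proof. by split=> [/eqmodP /asboolP|h] //; apply/eqmodP/asboolP. Qed.

Lemma finite_index_full A : (forall x, x \in A) -> finite_index A.
Proof.
move=> hA; apply/finite_indexP; exists unit, setT, (fun=> tt).
by split=> //.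
Qed.

Definition full_pred : {pred G} := fun _ => true.
Lemma full_closed : group_closed full_pred. Proof. by []. Qed.
Definition full : groupClosed G := mk_subgroup full_closed.
Lemma full_finite : finite_index full. Proof. exact: finite_index_full. Qed.
Definition id_iso : partial_iso :=
  PartialIso full_finite full_finite (id_is_iso full).

Definition pinv_fun f : G -> G :=
  fun y => xget 1 [set x | x \in dom f /\ f x = y].

Lemma pinv_funP f y : y \in cod f -> pinv_fun f y \in dom f /\ f (pinv_fun f y) = y.
Proof.
move=> By; rewrite /pinv_fun; case: xgetP => [x -> //|no].
by case: (pfunP f) => -[_ _ /(_ y By)[x Ax xy]] _; case: (no x).
Qed.

Lemma pinv_funK f x : x \in dom f -> pinv_fun f (f x) = x.
Proof.
move=> Ax; have [] := pinv_funP (is_iso_im (pfunP f) Ax).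
by move=> h; apply: is_iso_inj (pfunP f) h Ax.
Qed.

Lemma pinv_isoP f : is_iso (cod f) (dom f) (pinv_fun f).
Proof.
have fM := proj2 (pfunP f); split; first split.
- by move=> y By; case: (pinv_funP By).
- move=> x y /set_mem Bx /set_mem By e.
  by rewrite -(proj2 (pinv_funP Bx)) e (proj2 (pinv_funP By)).
- move=> x Ax; exists (f x); last exact: pinv_funK.
  exact: is_iso_im (pfunP f) Ax.
move=> x y Bx By; have [Ax fx] := pinv_funP Bx; have [Ay fy] := pinv_funP By.
by rewrite -{1}fx -{1}fy -fM // pinv_funK // gpredM.
Qed.

Definition inv_iso f : partial_iso :=
  PartialIso (cod_finite_index f) (dom_finite_index f) (pinv_isoP f).

(* Composition f \o g, from dom g :&: g^-1(dom f) to cod f :&: f(cod g) *)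
Definition comp_dom f g := mk_subgroup (preim_closed (dom f) (pfunP g)).
Definition comp_cod f g := mk_subgroup (preim_closed (cod g) (pinv_isoP f)).

Lemma comp_isoP f g : is_iso (comp_dom f g) (comp_cod f g) (fun x => f (g x)).
Proof.
split; first split.
- move=> x /andP[gx fx]; apply/andP; split; first exact: is_iso_im (pfunP f) fx.
  by rewrite pinv_funK //; exact: is_iso_im (pfunP g) gx.
- move=> x y /set_mem/andP[gx fx] /set_mem/andP[gy fy] e.
  exact: (is_iso_inj (pfunP g) gx gy (is_iso_inj (pfunP f) fx fy e)).
- move=> y /andP[By gy]; have [Ay fy] := pinv_funP By.
  have [Ax gx] := pinv_funP gy.
  by exists (pinv_fun g (pinv_fun f y)); [apply/andP; rewrite gx | rewrite gx].
move=> x y /andP[gx fx] /andP[gy fy].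
by rewrite (proj2 (pfunP g)) // (proj2 (pfunP f)).
Qed.

Definition comp_iso f g : partial_iso :=
  PartialIso
    (finite_index_preim (pfunP g) (dom_finite_index g) (dom_finite_index f))
    (finite_index_preim (pinv_isoP f) (cod_finite_index f) (cod_finite_index g))
    (comp_isoP f g).

Definition Comm_mul : Comm -> Comm -> Comm := lift_op2 Comm comp_iso.
Definition Comm_inv : Comm -> Comm := lift_op1 Comm inv_iso.
Definition Comm_one : Comm := \pi_Comm id_iso.

Lemma Comm_mulE f g : Comm_mul (\pi_Comm f) (\pi_Comm g) = \pi_Comm (comp_iso f g).
Proof.
rewrite /Comm_mul; unlock.
have /CommP[H [Hi Hf Hf' ef]] : \pi_Comm (repr (\pi_Comm f)) = \pi_Comm f by rewrite reprK.
have /CommP[K [Ki Kg Kg' eg]] : \pi_Comm (repr (\pi_Comm g)) = \pi_Comm g by rewrite reprK.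
set f' := repr _ in Hf ef *; set g' := repr _ in Kg eg *.
apply/CommP.
exists (cap K (mk_subgroup (preim_closed H (pfunP g)))); split.
- by apply/cap_finite/finite_index_preim => //; exact: dom_finite_index.
- move=> x /andP[xK /andP[xg xH]]; apply/andP; split; first exact: Kg.
  by rewrite (eg x xK); apply: Hf.
- by move=> x /andP[xK /andP[xg xH]]; apply/andP; split=> //; exact: Hf'.
- by move=> x /andP[xK /andP[xg xH]] /=; rewrite (eg x xK) (ef _ xH).
Qed.

Fact Comm_mulA : associative Comm_mul.
Proof.
elim/quotW=> f; elim/quotW=> g; elim/quotW=> h; rewrite !Comm_mulE.
apply/CommP; exists (dom (comp_iso (comp_iso f g) h)); split=> //.
- exact: dom_finite_index.
- move=> x /andP[xh /andP[xg xf]]; apply/andP; split=> //.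
  by apply/andP; split.
Qed.

Fact Comm_mul1 : left_id Comm_one Comm_mul.
Proof.
elim/quotW=> f; rewrite Comm_mulE; apply/CommP; exists (dom f); split=> //.
- exact: dom_finite_index.
- by move=> x xf; apply/andP.
Qed.

Fact Comm_mulg1 : right_id Comm_one Comm_mul.
Proof.
elim/quotW=> f; rewrite Comm_mulE; apply/CommP; exists (dom f); split=> //.
- exact: dom_finite_index.
Qed.

Lemma CommV f : Comm_mul (\pi_Comm (inv_iso f)) (\pi_Comm f) = Comm_one.
Proof.
rewrite Comm_mulE; apply/CommP; exists (dom f); split=> //.
- exact: dom_finite_index.
- by move=> x xf; apply/andP; split=> //; exact: is_iso_im (pfunP f) xf.
- by move=> x xf /=; rewrite pinv_funK.
Qed.

Lemma CommgV f : Comm_mul (\pi_Comm f) (\pi_Comm (inv_iso f)) = Comm_one.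
Proof.
rewrite Comm_mulE; apply/CommP; exists (cod f); split=> //.
- exact: cod_finite_index.
- by move=> x xf; apply/andP; split=> //; exact: is_iso_im (pinv_isoP f) xf.
- by move=> x xf /=; rewrite (proj2 (pinv_funP xf)).
Qed.

Lemma Comm_invE f : Comm_inv (\pi_Comm f) = \pi_Comm (inv_iso f).
Proof.
rewrite /Comm_inv; unlock; set g := repr _.
have gf : \pi_Comm g = \pi_Comm f by rewrite reprK.
rewrite -[LHS]Comm_mulg1 -(CommgV f) Comm_mulA -gf.
by rewrite CommV Comm_mul1.
Qed.

Fact Comm_mulV : left_inverse Comm_one Comm_inv Comm_mul.
Proof. by elim/quotW=> f; rewrite Comm_invE CommV. Qed.

Fact Comm_mulgV : right_inverse Comm_one Comm_inv Comm_mul.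
Proof. by elim/quotW=> f; rewrite Comm_invE CommgV. Qed.

HB.instance Definition _ :=
  isGroup.Build Comm Comm_mulA Comm_mul1 Comm_mulg1 Comm_mulV Comm_mulgV.

Lemma Comm_piM f g : \pi_Comm f * \pi_Comm g = \pi_Comm (comp_iso f g).
Proof. exact: Comm_mulE. Qed.

(* An automorphism of a finite index subgroup is a partial isomorphism whose
   domain and codomain are equal. *)
Definition AComm : groupClosed Comm :=
  generated [set c : Comm | exists2 f, dom f =i cod f & c = \pi_Comm f].

Definition virtual_center : set G :=
  [set z : G | exists2 H, finite_index H & {in H, forall x : G, z * x = x * z}].

Definition unique_root_property : Prop :=
  forall (g h : G) (n : nat), (0 < n)%N -> g ^+ n = h ^+ n -> g = h.

End Comm.

Arguments virtual_center G : clear implicits.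

(* Main.v *)
From mathcomp Require Import all_boot all_fingroup gseries jordanholder.
From mathcomp Require Import ssralg ssrint zify.
From mathcomp Require Import generic_quotient boolp classical_sets cardinality.
Require Import Defs.

(** Fix a finite group S.  Every finite group Q has a multiplicity m(Q), the
    number of its composition factors isomorphic to S, and m is additive on
    extensions ([multiplicityM]).  When C is normal of finite index in A, write
    m(A/C) for the multiplicity in the finite group A/C.

    For a finite index subgroup A of G, put
      v(A) = m(G/N) - m(A/N)
    where N is normal of finite index in G and contained in A.  This integer is
    what m(G/A) would be if A were normal; additivity makes it independent of N,
    and more generally v(B) - v(A) = m(A/C) - m(B/C) for C <= B <= A with C
    normal of finite index in A ([virtual_multiplicity_sub]).

    The right hand side is carried along by isomorphisms, which need not respect
    normality in G: if f : A -> B is an isomorphism and A' <= A has finite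
    index, then v(f A') - v(A') = v(B) - v(A) ([shift_restrict]).  Hence
      f : A -> B  |->  v(B) - v(A)
    depends on the class of f only, and it is a homomorphism from Comm(G) to the
    integers: the analogue for composition factors of the ratio of indices
    [G : B] / [G : A].  It vanishes on an automorphism of a finite index
    subgroup, where A = B, so it vanishes on AComm(G) ([Comm_shift_AComm]).

    Now let U_0, ..., U_n be isomorphic finite index normal subgroups, and let
    f_i : U_i -> U_0 be isomorphisms.  If [f_i] and [f_j] lie in the same coset
    of AComm(G), then v(U_i) = v(U_j), that is, G/U_i and G/U_j have equally
    many factors isomorphic to S.  For all S at once, this says that G/U_i and
    G/U_j have the same composition factors.  So the [f_i] lie in distinct
    cosets, and n is arbitrary. *)

Set Implicit Arguments.
Unset Strict Implicit.
Unset Printing Implicit Defensive.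

Local Open Scope group_scope.
Local Open Scope quotient_scope.

(** * Multiplicities of composition factors in finite groups *)

Section Multiplicity.
Variables (sT : finGroupType) (S : {group sT}).

Definition multiplicity (gT : finGroupType) (Q : {group gT}) : nat :=
  count (fun x : section gT => S \isog x)
    (mkfactors Q (xchoose (exists_comps Q))).

(** Jordan-Hoelder: the series chosen in the definition is immaterial. *)
Lemma multiplicity_comps (gT : finGroupType) (Q : {group gT}) s :
  comps Q s ->
  multiplicity Q = count (fun x : section gT => S \isog x) (mkfactors Q s).
Proof.
by move=> cs; apply/seq.permP/(JordanHolderUniqueness _ cs)/xchooseP.
Qed.

Lemma multiplicity1 (gT : finGroupType) (Q : {group gT}) :
  Q :=: 1 -> multiplicity Q = 0.
Proof.
move=> Q1; rewrite (@multiplicity_comps _ _ [::]) //.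
by rewrite /comps /= -val_eqE /= Q1 eqxx.
Qed.

Lemma multiplicity_maxnormal (gT : finGroupType) (N Q : {group gT}) :
  maxnormal N Q Q -> multiplicity Q = (S \isog Q / N) + multiplicity N.
Proof.
move=> maxN; have [s cs] := exists_comps N.
have csQ : comps Q (N :: s).
  by case/compsP: cs => ls ps; apply/compsP; rewrite /= maxN.
rewrite (multiplicity_comps csQ) (multiplicity_comps cs) /=.
congr (nat_of_bool _ + _).
exact: isog_transr (section_reprP (Q / N)%sec).
Qed.

(** Induction on the order: an isomorphism carries a maximal normal subgroup to
    a maximal normal subgroup, with isomorphic quotients. *)
Lemma multiplicity_isog (gT rT : finGroupType) (Q : {group gT}) (R : {group rT}) :
  Q \isog R -> multiplicity Q = multiplicity R.
Proof.
have [n] := ubnP #|Q|; elim: n Q R => // n IH Q R /ltnSE-cQ isoQR.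
have [Q1|ntQ] := eqVneq (Q :> {set gT}) 1.
  by rewrite !multiplicity1 //; apply/eqP; rewrite -(isog_eq1 isoQR) Q1.
have [N maxN] := ex_maxnormal_ntrivg ntQ.
have nsN := maxnormal_normal maxN.
case/isogP: isoQR => f injf fQ.
have maxM : maxnormal (f @* N)%G R R.
  by rewrite /= -fQ injm_maxnormal // normal_sub.
rewrite (multiplicity_maxnormal maxN) (multiplicity_maxnormal maxM).
have ltN : #|N| < n.
  exact: leq_trans (proper_card (maxnormal_proper maxN)) cQ.
rewrite (IH _ _ ltN (sub_isog (normal_sub nsN) injf)).
congr (nat_of_bool _ + _); apply: isog_transr.
have := sub_isog (subxx (Q / N)) (injm_quotm nsN injf).
by rewrite morphim_quotm /= fQ.
Qed.

(** Induction on the order of Q: a maximal normal subgroup of Q / N has the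
    form M / N with M maximal normal in Q, so Q and Q / N lose the same factor
    when they are replaced by M and M / N. *)
Lemma multiplicityM (gT : finGroupType) (N Q : {group gT}) :
  N <| Q -> multiplicity Q = multiplicity N + multiplicity (Q / N).
Proof.
have [n] := ubnP #|Q|; elim: n Q => // n IH Q /ltnSE-cQ nsNQ.
have [eNQ|neNQ] := eqVneq (N :> {set gT}) Q.
  rewrite (@multiplicity1 _ (Q / N)%G) /= -?eNQ ?trivg_quotient // addn0.
  by apply: multiplicity_isog; rewrite eNQ isog_refl.
have ntQN : Q / N != 1.
  apply: contra_neq neNQ => /trivgP.
  rewrite quotient_sub1 ?normal_norm // => sQN.
  by apply/eqP; rewrite finset.eqEsubset sQN normal_sub.
have [Mb maxMb] := ex_maxnormal_ntrivg ntQN.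
have nsMb := maxnormal_normal maxMb.
have [M defMb sNM nsMQ] := inv_quotientN nsNQ nsMb.
have maxM : maxnormal M Q Q.
  rewrite -quotient_simple // -(isog_simple (third_isog sNM nsNQ nsMQ)).
  by rewrite -defMb quotient_simple.
have nsNM : N <| M by apply: normalS nsNQ; rewrite // normal_sub.
rewrite (multiplicity_maxnormal maxM) (IH M) //; last first.
  exact: leq_trans (proper_card (maxnormal_proper maxM)) cQ.
rewrite (multiplicity_maxnormal maxMb) addnCA; congr (_ + (nat_of_bool _ + _)).
  by rewrite -(isog_transr _ (third_isog sNM nsNQ nsMQ)) -defMb.
by apply: multiplicity_isog; rewrite defMb isog_refl.
Qed.
End Multiplicity.

(** Letting S run through the entries of s itself is enough: the head of s has a
    partner in t, and removing both keeps all the counts equal. *)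
Lemma perm_of_multiplicities (gT rT : finGroupType)
    (s : seq (section gT)) (t : seq (section rT)) :
  (forall (sT : finGroupType) (S : {group sT}),
     count (fun x : section gT => S \isog x) s =
     count (fun y : section rT => S \isog y) t) ->
  exists2 t', perm_eq t' t &
    all2 (fun (x : section gT) (y : section rT) => x \isog y) s t'.
Proof.
elim: s t => [|x s IH] t e.
  case: t e => [|y t] e; first by exists [::].
  by have := e _ y; rewrite /= isog_refl.
have /hasP[y ty xy] : has (fun y : section rT => x \isog y) t.
  by rewrite has_count -e /= isog_refl.
have pt := perm_to_rem ty.
have [sT S|t' pt' al] := IH (rem y t).
  have := e _ S; rewrite (seq.permP pt) /= (isog_transr S xy).
  exact: addnI.
exists (y :: t'); last by rewrite /= xy.
by rewrite perm_sym (permPl pt) perm_cons perm_sym.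
Qed.

Lemma same_composition_factors_multiplicity (gT rT : finGroupType) :
  (forall (sT : finGroupType) (S : {group sT}),
     multiplicity S [set: gT]%G = multiplicity S [set: rT]%G) ->
  same_composition_factors gT rT.
Proof.
move=> e; have [s cs] := exists_comps [set: gT]%G.
have [t ct] := exists_comps [set: rT]%G.
exists s, t; split=> //; apply: perm_of_multiplicities => sT S.
by rewrite -(multiplicity_comps S cs) -(multiplicity_comps S ct).
Qed.

(** * Finite quotients of subgroups of an arbitrary group *)

Section FiniteQuotients.
Variable G : groupType.
Implicit Types A B C N : groupClosed G.

Definition normalizes A C := forall x a, x \in C -> a \in A -> x ^ a \in C.

(** A quotient of A is given by any map of A onto a finite group, with kernel
    C (or its intersection with A), rather than by cosets: cosets of C in A
    would need a group type on A, whereas these maps can be composed with an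
    isomorphism from another subgroup of G. *)
Definition quotient_map A C (gT : finGroupType) (Q : {group gT}) (q : G -> gT) :=
  [/\ {in A &, {morph q : x y / x * y}},
      forall y, y \in Q <-> exists2 x, x \in A & q x = y &
      {in A, forall x, x \in C <-> q x = 1}].

Definition has_finite_quotient A C :=
  exists (gT : finGroupType) (Q : {group gT}) (q : G -> gT), quotient_map A C Q q.

Lemma morph_in1 A (gT : finGroupType) (q : G -> gT) :
  {in A &, {morph q : x y / x * y}} -> q 1 = 1.
Proof.
move=> qM; have := qM 1 1 gpred1 gpred1; rewrite mulg1 => e.
by apply: (mulgI (q 1)); rewrite mulg1.
Qed.

Lemma morph_inV A (gT : finGroupType) (q : G -> gT) x :
  {in A &, {morph q : x y / x * y}} -> x \in A -> q x^-1 = (q x)^-1.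
Proof.
move=> qM Ax; apply: (mulgI (q x)).
by rewrite -qM ?gpredV // !mulgV (morph_in1 qM).
Qed.

Lemma exists_image_group A (gT : finGroupType) (q : G -> gT) :
  {in A &, {morph q : x y / x * y}} ->
  exists K : {group gT}, forall y, y \in K <-> exists2 x, x \in A & q x = y.
Proof.
move=> qM; pose im : {set gT} := [set y | `[< exists2 x, x \in A & q x = y >]].
have imP y : y \in im <-> exists2 x, x \in A & q x = y.
  by rewrite inE; split=> /asboolP.
suff gim : group_set im by exists (Group gim).
apply/group_setP; split.
  by apply/imP; exists 1; [exact: gpred1 | exact: morph_in1 qM].
move=> _ _ /imP[x Ax <-] /imP[y Ay <-]; apply/imP.
by exists (x * y); [exact: gpredM | exact: qM].
Qed.

Lemma quotient_map_isog A C (gT rT : finGroupType)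
    (Q : {group gT}) (R : {group rT}) (q : G -> gT) (r : G -> rT) :
  quotient_map A C Q q -> quotient_map A C R r -> Q \isog R.
Proof.
move=> [qM qQ qC] [rM rR rC].
pose h y := r (xget 1%g [set x | x \in A /\ q x = y]%classic).
have hq x : x \in A -> h (q x) = r x.
  move=> Ax; rewrite /h; case: xgetP => [z _ [Az qz]|/(_ x)[]//].
  have : z * x^-1 \in C.
    by apply/qC; rewrite ?gpredF // qM ?gpredV // (morph_inV qM) // qz mulgV.
  move/rC; rewrite gpredF // rM ?gpredV // (morph_inV rM) // => /(_ isT) e.
  by apply: (mulIg (r x)^-1); rewrite e mulgV.
have hM : {in Q &, {morph h : x y / x * y}}.
  by move=> _ _ /qQ[x Ax <-] /qQ[y Ay <-]; rewrite -qM // !hq ?gpredM // rM.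
pose hm := Morphism hM.
have injh : 'injm hm.
  apply/injmP=> _ _ /qQ[x Ax <-] /qQ[y Ay <-]; rewrite /= !hq // => e.
  have : x * y^-1 \in C.
    by apply/rC; rewrite ?gpredF // rM ?gpredV // (morph_inV rM) // e mulgV.
  move/qC; rewrite gpredF // qM ?gpredV // (morph_inV qM) // => /(_ isT) e'.
  by apply: (mulIg (q y)^-1); rewrite e' mulgV.
apply/isogP; exists hm => //; apply/setP => z.
apply/morphimP/idP => [[y _ /qQ[x Ax <-] ->]|].
  by rewrite /= hq //; apply/rR; exists x.
case/rR=> x Ax <-; have Qq : q x \in Q by apply/qQ; exists x.
by exists (q x); rewrite //= hq.
Qed.

(** Only A and B matter here, not how they sit in G: neither C nor C' has to be
    normal in G, and f need not extend to G. *)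
Lemma quotient_map_iso A B C C' f (gT : finGroupType) (Q : {group gT}) (q : G -> gT) :
  is_iso A B f -> {in A, forall x, x \in C <-> f x \in C'} ->
  quotient_map B C' Q q -> quotient_map A C Q (q \o f).
Proof.
move=> fi fC [qM qQ qC].
have fB x : x \in A -> f x \in B by exact: is_iso_im fi.
case: fi => -[_ _ fsurj] fM; split.
- by move=> x y Ax Ay; rewrite /= fM // qM ?fB.
- move=> y; split=> [/qQ[z /fsurj[x Ax <-] <-]|[x Ax <-]]; first by exists x.
  by apply/qQ; exists (f x); rewrite ?fB.
- move=> x Ax; have qCx := qC _ (fB x Ax).
  by split=> [/(fC x Ax)/qCx|/qCx/(fC x Ax)].
Qed.

Section Multiplicity.
Variables (sT : finGroupType) (S : {group sT}).

(** The multiplicity of S in A / C, with value 0 unless C is normal of finite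
    index in A. *)
Definition relative_multiplicity A C : nat :=
  xget 0 [set n | exists (gT : finGroupType) (Q : {group gT}) (q : G -> gT),
    quotient_map A C Q q /\ multiplicity S Q = n]%classic.

Lemma relative_multiplicityE A C (gT : finGroupType) (Q : {group gT}) q :
  quotient_map A C Q q -> relative_multiplicity A C = multiplicity S Q.
Proof.
move=> Qq; rewrite /relative_multiplicity.
case: xgetP => [n -> [rT [R [r [Rr <-]]]]|no].
  exact/multiplicity_isog/(quotient_map_isog Rr Qq).
by case: (no (multiplicity S Q)); exists gT, Q, q.
Qed.

Lemma relative_multiplicity_iso A B C C' f :
  is_iso A B f -> {in A, forall x, x \in C <-> f x \in C'} ->
  has_finite_quotient B C' ->
  relative_multiplicity A C = relative_multiplicity B C'.
Proof.
move=> fi fC [gT [Q [q Qq]]].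
rewrite (relative_multiplicityE Qq).
by rewrite (relative_multiplicityE (quotient_map_iso fi fC Qq)).
Qed.

(** The image K of C in A / N is a copy of C / N, and (A / N) / K is a copy of
    A / C. *)
Lemma relative_multiplicityM A C N :
  has_finite_quotient A N -> {subset N <= C} -> {subset C <= A} ->
  normalizes A C ->
  relative_multiplicity A N =
    relative_multiplicity C N + relative_multiplicity A C.
Proof.
move=> [gT [Q [q Qq]]] sNC sCA nCA; have [qM qQ qN] := Qq.
have qMC : {in C &, {morph q : x y / x * y}}.
  by move=> x y /sCA Ax /sCA; exact: qM.
have [K qK] := exists_image_group qMC.
have Kq : quotient_map C N K q by split=> // x /sCA; exact: qN.
have nsKQ : K <| Q.
  apply/normalP; split.
    by apply/fintype.subsetP => _ /qK[x /sCA Ax <-]; apply/qQ; exists x.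
  move=> _ /qQ[a Aa <-]; apply/eqP; rewrite finset.eqEcard cardJg leqnn andbT.
  apply/fintype.subsetP => _ /imsetP[_ /qK[x Cx <-] ->]; apply/qK.
  exists (x ^ a); first exact: nCA.
  have Ax := sCA x Cx.
  by rewrite !conjgE !qM ?gpredM ?gpredV // (morph_inV qM).
have nKQ y : y \in Q -> y \in 'N(K) by apply/fintype.subsetP/normal_norm.
have qA x : x \in A -> q x \in Q by move=> Ax; apply/qQ; exists x.
have Rq : quotient_map A C (Q / K)%G (coset K \o q).
  split.
  - by move=> x y Ax Ay; rewrite /= qM // morphM ?nKQ ?qA.
  - move=> y; split.
      by case/morphimP=> z _ /qQ[x Ax <-] ->; exists x.
    by case=> x Ax <-; rewrite mem_quotient ?qA.
  - move=> x Ax; split=> [Cx|/=].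
      by apply: coset_id; apply/qK; exists x.
    move/(coset_idr (nKQ _ (qA _ Ax)))/qK => [z Cz qz].
    have Az := sCA z Cz; rewrite -(mulgKV z x) gpredM //; apply: sNC.
    by apply/qN; rewrite ?gpredF // qM ?gpredV // (morph_inV qM) // qz mulgV.
rewrite (relative_multiplicityE Qq) (relative_multiplicityE Kq).
by rewrite (relative_multiplicityE Rq) (multiplicityM S nsKQ).
Qed.

Lemma relative_multiplicity_refl A : relative_multiplicity A A = 0.
Proof.
suff Aq : quotient_map A A (1%G : {group sT}) (fun=> 1).
  by rewrite (relative_multiplicityE Aq) multiplicity1.
split=> // [x y _ _|y]; first by rewrite mulg1.
split=> [/set1gP->|[_ _ <-]]; last exact: group1.
by exists 1; first exact: gpred1.
Qed.

End Multiplicity.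

Lemma finite_index_sub A B : {subset A <= B} -> finite_index A -> finite_index B.
Proof.
move=> sAB Afin; apply/finite_indexP.
exists (cosets A), setT, (fun x => \pi_(cosets A) x); split=> // x y /cosetsP.
exact: sAB.
Qed.

Lemma finite_index_bigcap (T : eqType) (s : seq T) (F : T -> groupClosed G) :
  (forall t, finite_index (F t)) ->
  exists2 H : groupClosed G, finite_index H & {in s, forall t, {subset H <= F t}}.
Proof.
move=> Ffin; elim: s => [|t s [H Hfin sH]].
  by exists (full G) => //; exact: full_finite.
exists (cap H (F t)); first exact: cap_finite.
move=> u; rewrite in_cons => /orP[/eqP->|us] x /andP[Hx Fx] //.
exact: sH us x Hx.
Qed.

Definition core_pred A : {pred G} := fun x => `[< forall g, x ^ g \in A >].

Lemma core_closed A : group_closed (core_pred A).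
Proof.
split; first by apply/asboolP => g; rewrite conj1g; exact: gpred1.
move=> x y /asboolP cx /asboolP cy; apply/asboolP => g.
by rewrite conjMg conjVg; exact: gpredF.
Qed.

Definition core A : groupClosed G := mk_subgroup (core_closed A).

Lemma coreP A x : x \in core A <-> forall g, x ^ g \in A.
Proof. by split=> /asboolP. Qed.

Lemma core_sub A : {subset core A <= A}.
Proof. by move=> x /coreP/(_ 1); rewrite conjg1. Qed.

Lemma core_normal A x g : x \in core A -> x ^ g \in core A.
Proof. by move=> /coreP cx; apply/coreP => h; rewrite -conjgM. Qed.

Lemma conjg_is_iso (g : G) : is_iso (full G) (full G) (conjg^~ g).
Proof.
split; last by move=> x y _ _; rewrite conjMg.
split=> // [x y _ _|y _]; first exact: conjg_inj.
by exists (y ^ g^-1) => //; rewrite conjgKV.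
Qed.

(** The conjugate of A by g depends on the coset of g only, so the core is an
    intersection of finitely many conjugates. *)
Lemma core_finite_index A : finite_index A -> finite_index (core A).
Proof.
move=> Afin; have /finite_seqP[s hs] : finite_set [set: cosets A] := Afin.
pose F (z : cosets A) := mk_subgroup (preim_closed A (conjg_is_iso (repr z))).
have Ffin z : finite_index (F z).
  by apply: finite_index_preim => //; exact: full_finite.
have [H Hfin sH] := finite_index_bigcap s Ffin.
apply: finite_index_sub Hfin => x Hx; apply/coreP => g.
have zs : \pi_(cosets A) g \in s.
  by have : [set: cosets A]%classic (\pi_(cosets A) g) by []; rewrite hs.
have /andP[_ Ax] := sH _ zs x Hx.
have Ag : (repr (\pi_(cosets A) g))^-1 * g \in A by apply/cosetsP; rewrite reprK.
by rewrite -[g](mulKVg (repr (\pi_(cosets A) g))) conjgM gpredJ.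
Qed.

Lemma fin_normal_quotient A (U : fin_normal_subgroup G) : has_finite_quotient A U.
Proof.
have piM : {in A &, {morph \pi_(quot U) : x y / x * y}}.
  by move=> x y _ _; exact: quot_piM.
have [K piK] := @exists_image_group A (fin_quot U) _ piM.
exists (fin_quot U), K, (\pi_(quot U)); split=> // x _.
rewrite -[1]/(\pi_(quot U) 1); split=> [Ux|/quotP].
  by apply/quotP; rewrite mulg1 gpredV.
by rewrite mulg1 gpredV.
Qed.

Definition fin_core A (Afin : finite_index A) : fin_normal_subgroup G :=
  @FinNormalSubgroup G (NormalSubgroup (@core_normal A)) (core_finite_index Afin).

Lemma core_quotient A B : finite_index B -> has_finite_quotient A (core B).
Proof. by move=> Bfin; exact: fin_normal_quotient A (fin_core Bfin). Qed.

End FiniteQuotients.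

(** * The shift homomorphism on commensurations *)

Section Shift.
Variables (G : groupType) (sT : finGroupType) (S : {group sT}).
Implicit Types (A B C N H : groupClosed G) (f g : partial_iso G).

Local Notation mu := (relative_multiplicity S).

(** The multiplicity of S in G / A as it would be for A normal. *)
Definition virtual_multiplicity A : int :=
  ((mu (full G) (core A))%:Z - (mu A (core A))%:Z)%R.

(** The core of A may be replaced by any smaller one: both terms then grow by
    the multiplicity of S in core A / core B. *)
Lemma virtual_multiplicityE A B :
  finite_index A -> finite_index B -> {subset B <= A} ->
  virtual_multiplicity A = ((mu (full G) (core B))%:Z - (mu A (core B))%:Z)%R.
Proof.
move=> Afin Bfin sBA.
have sBA' : {subset core B <= core A}.
  by move=> x /coreP h; apply/coreP => g; exact/sBA/h.
have e (D : groupClosed G) : {subset A <= D} ->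
    mu D (core B) = mu (core A) (core B) + mu D (core A).
  move=> sAD; apply: relative_multiplicityM => //; first exact: core_quotient.
    by move=> x /core_sub; exact: sAD.
  by move=> x a cx _; exact: core_normal.
rewrite /virtual_multiplicity (e (full G)) // (e A) //; lia.
Qed.

(** The right hand side mentions A, B and C only, so it can be transported by
    an isomorphism defined on A. *)
Lemma virtual_multiplicity_sub A B C :
  finite_index A -> finite_index B -> finite_index C ->
  {subset C <= B} -> {subset B <= A} -> normalizes A C ->
  (virtual_multiplicity B - virtual_multiplicity A)%R =
    ((mu A C)%:Z - (mu B C)%:Z)%R.
Proof.
move=> Afin Bfin Cfin sCB sBA nCA.
have sCA : {subset C <= A} by move=> x /sCB/sBA.
rewrite (virtual_multiplicityE Afin Cfin) // (virtual_multiplicityE Bfin Cfin) //.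
rewrite (relative_multiplicityM _ (core_quotient A Cfin) (@core_sub _ C) sCA) //.
rewrite (relative_multiplicityM _ (core_quotient B Cfin) (@core_sub _ C) sCB).
  lia.
by move=> x b Cx /sBA; exact: nCA.
Qed.

Lemma virtual_multiplicity_normal (U : fin_normal_subgroup G) :
  virtual_multiplicity U = (multiplicity S [set: fin_quot U])%:Z%R.
Proof.
have Ufin := fin_normal_index U.
have nU A : normalizes A U by move=> x a Ux _; exact: normal_conj.
have := @virtual_multiplicity_sub (full G) U U (full_finite G) Ufin Ufin.
rewrite relative_multiplicity_refl => /(_ _ _ (nU _)) e.
have f0 : virtual_multiplicity (full G) = 0%R.
  by rewrite (virtual_multiplicityE (full_finite G) (full_finite G)) //; lia.
have Uq : quotient_map (full G) U [set: fin_quot U]%G (\pi_(quot U)).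
  split=> [x y _ _|y|x _]; first exact: quot_piM.
    by split=> // _; exists (repr y) => //; rewrite reprK.
  rewrite -[1]/(\pi_(quot U) 1); split=> [Ux|/quotP].
    by apply/quotP; rewrite mulg1 gpredV.
  by rewrite mulg1 gpredV.
have := e (fun x => id) (fun x _ => isT); rewrite f0.
rewrite (relative_multiplicityE S Uq); lia.
Qed.

Definition shift f : int :=
  (virtual_multiplicity (cod f) - virtual_multiplicity (dom f))%R.

Lemma virtual_multiplicity_ext A B :
  finite_index A -> finite_index B -> A =i B ->
  virtual_multiplicity A = virtual_multiplicity B.
Proof.
move=> Afin Bfin eAB.
have := @virtual_multiplicity_sub A B (core A) Afin Bfin
  (core_finite_index Afin).
have -> : mu B (core A) = mu A (core A).
  apply: (@relative_multiplicity_iso _ _ _ B A _ _ id); last exact: core_quotient.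
    split=> //; split=> [x Bx|//|x Ax]; first by rewrite /= eAB.
    by exists x; rewrite //= -eAB.
  by [].
move=> /(_ _ _ _) e.
suff : (virtual_multiplicity B - virtual_multiplicity A = 0)%R by lia.
rewrite e ?GRing.subrr // => [x /core_sub|x|x a cx _]; rewrite ?eAB //.
exact: core_normal.
Qed.

(** With C the core of the domain of g, its image under f is normal in the
    codomain of f, though perhaps not in G, and f matches the two differences given
    by [virtual_multiplicity_sub] for C and for its image. *)
Lemma shift_restrict f g :
  {subset dom g <= dom f} -> {in dom g, g =1 f} -> shift g = shift f.
Proof.
move=> sgf egf; pose C := core (dom g).
have Cfin : finite_index C := core_finite_index (dom_finite_index g).
have sCg : {subset C <= dom g} by exact: core_sub.
pose fC := mk_subgroup (preim_closed C (pinv_isoP f)).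
have fCP y : y \in fC <-> y \in cod f /\ pinv_fun f y \in C by split=> /andP.
have fCfin : finite_index fC.
  by apply: finite_index_preim => //; exact: cod_finite_index.
have sg : {subset cod g <= cod f}.
  move=> y /pinv_funP[gx <-]; rewrite egf //.
  by apply: is_iso_im (pfunP f) _; exact: sgf.
have epinv y : y \in cod g -> pinv_fun f y = pinv_fun g y.
  by move=> /pinv_funP[gx {1}<-]; rewrite egf // pinv_funK //; exact: sgf.
have sfC : {subset fC <= cod g}.
  move=> y /fCP[By Cy]; rewrite -(proj2 (pinv_funP By)) -egf ?sCg //.
  by apply: is_iso_im (pfunP g) _; exact: sCg.
have nfC : normalizes (cod f) fC.
  move=> y b /fCP[By Cy] Bb; apply/fCP; split; first exact: gpredJ.
  have pM := proj2 (pinv_isoP f).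
  have -> : pinv_fun f (y ^ b) = pinv_fun f y ^ pinv_fun f b.
    by rewrite !conjgE !pM ?gpredM ?gpredV // (is_isoV (pinv_isoP f)).
  exact: core_normal.
have nC : normalizes (dom f) C by move=> x a Cx _; exact: core_normal.
have ef := virtual_multiplicity_sub (cod_finite_index f) (cod_finite_index g)
  fCfin sfC sg nfC.
have eg := virtual_multiplicity_sub (dom_finite_index f) (dom_finite_index g)
  Cfin sCg sgf nC.
have e1 : mu (cod f) fC = mu (dom f) C.
  apply: (relative_multiplicity_iso _ (pinv_isoP f)); last first.
    by apply: core_quotient; exact: dom_finite_index.
  by move=> y By; split=> [/fCP[]//|Cy]; apply/fCP.
have e2 : mu (cod g) fC = mu (dom g) C.
  apply: (relative_multiplicity_iso _ (pinv_isoP g)); last first.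
    by apply: core_quotient; exact: dom_finite_index.
  move=> y By; rewrite -epinv //; split=> [/fCP[]//|Cy].
  by apply/fCP; split=> //; exact: sg.
by rewrite /shift; move: ef eg; rewrite e1 e2; lia.
Qed.

Definition id_on A (Afin : finite_index A) : partial_iso G :=
  PartialIso Afin Afin (id_is_iso A).

Lemma shift_comp f g : shift (comp_iso f g) = (shift f + shift g)%R.
Proof.
(* Cut g and f down so that the codomain of g' is the domain of f'. *)
pose g' := comp_iso (id_on (dom_finite_index f)) g.
pose f' := comp_iso f (id_on (cod_finite_index g)).
have <- : shift g' = shift g by apply: shift_restrict => // x /andP[].
have <- : shift f' = shift f by apply: shift_restrict => // x /andP[].
have e : virtual_multiplicity (cod g') = virtual_multiplicity (dom f').
  apply: virtual_multiplicity_ext => [||y].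
  - exact: cod_finite_index.
  - exact: dom_finite_index.
  apply/andP/andP=> [[fy gy]|[gy fy]]; split=> //.
    by rewrite (@pinv_funK _ (id_on (dom_finite_index f)) y fy) in gy.
  by rewrite (@pinv_funK _ (id_on (dom_finite_index f)) y fy).
have ed : dom g' = dom (comp_iso f g) by [].
have ec : cod f' = cod (comp_iso f g) by [].
rewrite /shift -ed -ec e; lia.
Qed.

Lemma shift_eqmod f g : \pi_(Comm G) f = \pi_(Comm G) g -> shift f = shift g.
Proof.
move=> /CommP[H [Hfin sHf sHg e]].
have r h : {subset H <= dom h} -> shift (comp_iso h (id_on Hfin)) = shift h.
  by move=> sHh; apply: shift_restrict => // x /andP[_].
rewrite -(r f) // -(r g) //.
apply: shift_restrict => [x /andP[Hx _]|x /andP[Hx _]].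
  by apply/andP; split=> //; exact: sHg.
exact: e.
Qed.

Definition Comm_shift (c : Comm G) : int := shift (repr c).

Lemma Comm_shiftE f : Comm_shift (\pi_(Comm G) f) = shift f.
Proof. by apply: shift_eqmod; rewrite reprK. Qed.

Lemma Comm_shiftM c d : Comm_shift (c * d) = (Comm_shift c + Comm_shift d)%R.
Proof.
elim/quotW: c => f; elim/quotW: d => g.
by rewrite Comm_piM !Comm_shiftE shift_comp.
Qed.

Lemma Comm_shift1 : Comm_shift 1 = 0%R.
Proof. by have := Comm_shiftM 1 1; rewrite mulg1; lia. Qed.

Lemma Comm_shiftV c : Comm_shift c^-1 = (- Comm_shift c)%R.
Proof. by have := Comm_shiftM c^-1 c; rewrite mulVg Comm_shift1; lia. Qed.

Definition shift_kernel_pred : {pred Comm G} := fun c => Comm_shift c == 0%R.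

Lemma shift_kernel_closed : group_closed shift_kernel_pred.
Proof.
split; first by apply/eqP/Comm_shift1.
by move=> c d /eqP c0 /eqP d0; apply/eqP; rewrite Comm_shiftM Comm_shiftV c0 d0.
Qed.

Lemma Comm_shift_AComm c : c \in AComm G -> Comm_shift c = 0%R.
Proof.
move=> /asboolP/(_ (mk_subgroup shift_kernel_closed)) h; apply/eqP/h.
move=> _ [f edc ->]; apply/eqP; rewrite Comm_shiftE /shift.
rewrite (virtual_multiplicity_ext _ _ edc) ?GRing.subrr //.
  exact: dom_finite_index.
exact: cod_finite_index.
Qed.

End Shift.

(** * Infinite index of AComm *)

Lemma infinite_index_seq (G : groupType) (H : groupClosed G) :
  (forall n, exists c : 'I_n -> G, forall i j, (c i)^-1 * c j \in H -> i = j) ->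
  ~ finite_index H.
Proof.
move=> many /finite_seqP[s hs]; have [c cH] := many (size s).+1.
pose p i := \pi_(cosets H) (c i).
have pinj : injective p by move=> i j /cosetsP; exact: cH.
have : size (map p (enum 'I_(size s).+1)) <= size s.
  apply: uniq_leq_size; first by rewrite (map_inj_uniq pinj) enum_uniq.
  by move=> z _; have : [set: cosets H]%classic z by []; rewrite hs.
by rewrite size_map size_enum_ord ltnn.
Qed.

Local Open Scope classical_set_scope.
Local Open Scope group_scope.

Theorem theorem5p6 (G : groupType)
  (Gfg : finitely_generated G)
  (Ga : virtual_center G = [set 1] \/ unique_root_property G)
  (Gb : forall n : nat, exists U : 'I_n -> fin_normal_subgroup G,
     (forall i j : 'I_n, isomorphic (U i) (U j)) /\
     (forall i j : 'I_n, i <> j ->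
        ~ same_composition_factors (fin_quot (U i)) (fin_quot (U j)))) :
  ~ finite_index (AComm G).
Proof.
apply: infinite_index_seq => -[|n]; first by exists (fun=> 1); case.
have [U [isoU distU]] := Gb n.+1.
(* All the maps have the same codomain, so that a quotient of two of them
   compares two domains. *)
have {isoU}[f f_iso] := choice (fun i => isoU i ord0).
pose F i :=
  PartialIso (fin_normal_index (U i)) (fin_normal_index (U ord0)) (f_iso i).
exists (fun i => \pi_(Comm G) (F i)) => i j ij; apply: contrapT => /distU; apply.
apply: same_composition_factors_multiplicity => sT S.
have := Comm_shift_AComm S ij.
rewrite Comm_shiftM Comm_shiftV !Comm_shiftE /shift /=.
rewrite !virtual_multiplicity_normal; lia.
Qed.
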